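(* Let $A\in L^{\infty}(\mathfrak{S},\mathbb{R}^{n\times n};\mu)$ and $B\in L^{\infty}(\mathfrak{S},\mathbb{R}^{n\times m};\mu)$. Assume that $L^2(\mathfrak{S},H;\mu)$ is infinite dimensional. Then the system $\partial_t^\alpha x_\sigma(t)=A(\sigma)x_\sigma(t)+B(\sigma)u(t)$, $x_\sigma(0)=x_{0,\sigma}$, is not exactly simultaneously controllable in time $T$.
   Context: Setting: $\alpha\in(0,1)$, $T>0$, $n,m\ge 1$, $H=\mathbb{R}^n$ and $U=\mathbb{R}^m$ with their Euclidean structures, and $(\mathfrak{S},\mathcal{F},\mu)$ is a probability space. For a square matrix $M$, $E_\alpha(M)=\sum_{k=0}^\infty \frac{M^k}{\Gamma(\alpha k+1)}$ and $E_{\alpha,\alpha}(M)=\sum_{k=0}^\infty \frac{M^k}{\Gamma(\alpha k+\alpha)}$. Here $\partial_t^\alpha$ is the left Caputo derivative $\partial_t^\alpha g(t)=\frac{1}{\Gamma(1-\alpha)}\int_0^t (t-s)^{-\alpha}g'(s)\,ds$. For $x_{0,\sigma}\in H$ and $u\in L^\infty(0,T;U)$ (with $u$ independent of $\sigma$) the solution of the system is, for $\mu$-a.e. $\sigma$ and $t\in[0,T]$, $$x_\sigma(t;x_{0,\sigma};u)=E_\alpha(t^\alpha A(\sigma))x_{0,\sigma}+\int_0^t (t-s)^{\alpha-1}E_{\alpha,\alpha}((t-s)^\alpha A(\sigma))B(\sigma)u(s)\,ds.$$ The system is exactly simultaneously controllable in time $T$ if for every $x_{0,\bullet},x_{1,\bullet}\in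 L^2(\mathfrak{S},H;\mu)$ there exists $u\in L^\infty(0,T;U)$ such that $x_\sigma(T;x_{0,\sigma};u)=x_{1,\sigma}$ for $\mu$-a.e. $\sigma\in\mathfrak{S}$. *)

(* Defs.v *)
From HB Require Import structures.
From mathcomp Require Import all_boot all_order all_algebra.
From mathcomp Require Import all_classical all_reals all_analysis.

Set Implicit Arguments.
Unset Strict Implicit.
Unset Printing Implicit Defensive.

Import Order.TTheory GRing.Theory Num.Theory.
Import numFieldTopology.Exports numFieldNormedType.Exports.

Local Open Scope classical_set_scope.
Local Open Scope ring_scope.

Section matrix_valued_functions.
Context {R : realType} {d : measure_display} {T : measurableType d}.
Context (mu : {measure set T -> \bar R}).
Context {p q : nat}.
Implicit Types (D : set T) (f : T -> 'M[R]_(p, q)).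

(* The library's norm `|M| on matrices is the maximum norm. *)
Definition euclidean_norm (M : 'M[R]_(p, q)) : R :=
  Num.sqrt (\sum_(i < p) \sum_(j < q) M i j ^+ 2).

Definition mx_measurable_fun D f : Prop :=
  forall i j, measurable_fun D (fun x => f x i j).

(* Elements of L^r(D, R^(p x q); mu) are represented by functions; almost
   everywhere equality is stated explicitly wherever it is meant. *)
Definition mxLp (r : \bar R) D f : Prop :=
  mx_measurable_fun D f /\
  finite_norm mu r ((fun x => euclidean_norm (f x)) \_ D).

Definition mx_integral D f : 'M[R]_(p, q) :=
  \matrix_(i, j) \int[mu]_(x in D) f x i j.

End matrix_valued_functions.

(* No finite family spans L^2(S, R^n; mu) modulo almost everywhere equality. *)
Definition infinite_dimensional_L2 {R : realType} {d : measure_display}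
    {S : measurableType d} (mu : {measure set S -> \bar R}) (n : nat) : Prop :=
  ~ exists (k : nat) (e : 'I_k -> S -> 'cV[R]_n),
      (forall i, mxLp mu 2%:E setT (e i)) /\
      forall x : S -> 'cV[R]_n, mxLp mu 2%:E setT x ->
        exists c : 'I_k -> R,
          {ae mu, forall s, x s = \sum_(i < k) c i *: e i s}.

Section fractional_system.
Context {R : realType}.

Definition Gamma (x : R) : R :=
  \int[lebesgue_measure]_(t in `]0, +oo[) (t `^ (x - 1) * expR (- t)).

(* E_{alpha, beta}; the one-parameter E_alpha is the case beta = 1. *)
Definition mittag_leffler {n : nat} (alpha beta : R) (M : 'M[R]_n) : 'M[R]_n :=
  limn (series (fun k => (Gamma (alpha * k%:R + beta))^-1 *: M ^+ k)).

Definition solution {n m : nat} (alpha : R) (A : 'M[R]_n) (B : 'M[R]_(n, m))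
    (x0 : 'cV[R]_n) (u : R -> 'cV[R]_m) (t : R) : 'cV[R]_n :=
  mittag_leffler alpha 1 (t `^ alpha *: A) *m x0 +
  mx_integral lebesgue_measure `]0, t[
    (fun s => (t - s) `^ (alpha - 1) *:
      (mittag_leffler alpha alpha ((t - s) `^ alpha *: A) *m B *m u s)).

Definition exactly_simultaneously_controllable {d : measure_display}
    {S : measurableType d} (mu : {measure set S -> \bar R}) {n m : nat}
    (alpha T : R) (A : S -> 'M[R]_n) (B : S -> 'M[R]_(n, m)) : Prop :=
  forall x0 x1 : S -> 'cV[R]_n,
    mxLp mu 2%:E setT x0 -> mxLp mu 2%:E setT x1 ->
    exists u : R -> 'cV[R]_m,
      mxLp lebesgue_measure +oo%E `]0, T[ u /\
      {ae mu, forall s, solution alpha (A s) (B s) (x0 s) u T = x1 s}.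

End fractional_system.

(* Main.v *)
Require Import Defs.
From mathcomp Require Import all_boot all_order all_algebra.
From mathcomp Require Import all_classical all_reals all_analysis.
From mathcomp Require Import measurable_realfun ess_sup_inf lra ring.
Import Order.TTheory GRing.Theory Num.Theory.
Import numFieldTopology.Exports numFieldNormedType.Exports.
Local Open Scope classical_set_scope.
Local Open Scope ring_scope.

(* Steering from x_0 = 0 and expanding the Mittag-Leffler kernel shows that every
   reachable target is the sum of a series of terms A(s)^k B(s) v_k, where the
   vectors v_k do not depend on s; as 1 / Gamma decays superexponentially, the
   tail from k = p on is O(2^-p), uniformly in s.  If L^2 is infinite
   dimensional, S contains infinitely many disjoint sets of positive measure;
   group them in blocks, the p-th one made of p m + 1 sets E_(p,j).  Counting
   dimensions, some nonzero xi_p satisfies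
   \sum_j xi_(p,j) \int_(E_(p,j)) (A^k B)_(0,l) = 0 for all k < p, l < m.
   The target whose first coordinate is y = sgn xi_(p,j) on E_(p,j) is bounded,
   and pairing it with g_p = \sum_j xi_(p,j) 1_(E_(p,j)) kills the first p terms
   of the series, so that \int |g_p| = \int g_p y = O(2^-p) \int |g_p|, which is
   absurd for p large. *)

(** * Superexponential decay of 1 / Gamma *)

(* No finiteness of the integral is needed: were it infinite, [Gamma x] and its
   inverse would be the junk value 0. *)
Lemma invr_Gamma_le (R : realType) (M x : R) : 0 < M -> 0 <= x ->
  0 <= (Gamma x)^-1 <= (M + 1) * expR (M + 1) * M `^ (- x).
Proof.
move=> M0 x0.
have mf : measurable_fun [set: R] (EFin \o (fun t : R => t `^ (x - 1) * expR (- t))).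
  apply/measurable_EFinP; apply: measurable_funM; first exact: measurable_powR.
  by apply: measurableT_comp => //; exact: measurable_expR.
have G0 : 0 <= Gamma x.
  by apply: Rintegral_ge0 => t _; rewrite mulr_ge0 ?powR_ge0 ?expR_ge0.
rewrite invr_ge0 G0/=.
(* Only [M, M + 1], of length 1, is kept: there t^x is least at M, while t^-1 and e^-t are least at
   M + 1. *)
have : (((M + 1)^-1 * expR (- (M + 1)) * M `^ x)%:E <=
    \int[@lebesgue_measure R]_(t in `]0%R, +oo[) (t `^ (x - 1) * expR (- t))%:E)%E.
  apply: (@le_trans _ _ (\int[@lebesgue_measure R]_(t in `[M, (M + 1)%R])
      ((M + 1)^-1 * expR (- (M + 1)) * M `^ x)%:E)%E).
    rewrite integral_cst//= lebesgue_measure_itv/= lte_fin ltrDl ltr01.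
    by rewrite -EFinD [M + 1 - M]addrAC subrr add0r mule1.
  apply: (@le_trans _ _ (\int[@lebesgue_measure R]_(t in `[M, (M + 1)%R])
      (t `^ (x - 1) * expR (- t))%:E)%E).
    apply: ge0_le_integral => //=.
    - by move=> t _; rewrite lee_fin !mulr_ge0 ?powR_ge0 ?expR_ge0// invr_ge0 addr_ge0// ltW.
    - exact: measurable_funS mf.
    move=> t; rewrite in_itv/= => /andP[Mt tM]; have t0 := lt_le_trans M0 Mt.
    rewrite lee_fin powRD; last by rewrite (gt_eqF t0) implybT.
    rewrite powR_inv1 ?(ltW t0)// mulrAC [X in _ <= X * _]mulrC.
    have M1 : 0 < M + 1 by rewrite addr_gt0.
    rewrite !ler_pM ?mulr_ge0 ?expR_ge0 ?powR_ge0 ?invr_ge0 ?(ltW M1) ?lef_pV2 ?posrE//.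
      by apply: ge0_ler_powR => //; rewrite nnegrE ltW.
    by rewrite ler_expR lerN2.
  apply: ge0_subset_integral => //=.
  - exact: measurable_funS mf.
  - by move=> t _; rewrite lee_fin mulr_ge0 ?powR_ge0 ?expR_ge0.
  - by move=> t /=; rewrite !in_itv/= andbT => /andP[/(lt_le_trans M0)].
rewrite /Gamma /Rintegral; case: (\int[_]_(_ in _) _)%E => [g| |]//=; last first.
  by rewrite invr0 !mulr_ge0 ?powR_ge0 ?expR_ge0// addr_ge0// ltW.
rewrite lee_fin => gK.
have P0 : 0 < (M + 1)^-1 * expR (- (M + 1)) * M `^ x.
  by rewrite !mulr_gt0 ?powR_gt0 ?expR_gt0// invr_gt0 addr_gt0.
have : g^-1 <= ((M + 1)^-1 * expR (- (M + 1)) * M `^ x)^-1.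
  by rewrite lef_pV2 ?posrE// (lt_le_trans P0).
by rewrite !invfM invrK -expRN opprK -powRN.
Qed.

(** The parameter M of the previous bound is free. Taking M = q^(-1/alpha) turns M^(-alpha k) into
    q^k, so any ratio q, however small, is available. *)
Lemma invr_Gamma_geometric (R : realType) (alpha beta q : R) :
  0 < alpha -> 0 <= beta -> 0 < q ->
  exists2 C : R, 0 <= C &
    forall k, `|(Gamma (alpha * k%:R + beta))^-1| <= C * q ^+ k.
Proof.
move=> a0 b0 q0; pose M := (q `^ (- alpha^-1)).
have M0 : 0 < M by rewrite powR_gt0.
have MV : M `^ (- alpha) = q.
  by rewrite /M -powRrM mulrNN mulVf ?gt_eqF// powRr1// ltW.
exists ((M + 1) * expR (M + 1) * M `^ (- beta)).
  by rewrite !mulr_ge0 ?powR_ge0 ?expR_ge0// addr_ge0// ltW.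
move=> k; have x0 : 0 <= alpha * k%:R + beta by rewrite addr_ge0// mulr_ge0// ltW.
have /andP[G0 GM] := invr_Gamma_le R M _ M0 x0.
rewrite ger0_norm// (le_trans GM)// opprD powRD; last by rewrite (gt_eqF M0) implybT.
by rewrite -mulNr powRrM MV powR_mulrn ?(ltW q0)// [q ^+ k * _]mulrC mulrA.
Qed.

(** * Integrability of the singular time kernel *)

(** For a < 1 the integrand blows up at T. On compact intervals that stay away from T, the
    antiderivative -(T - s)^a / a bounds the integral by T^a / a, and monotone convergence passes to
    the limit. *)
Lemma integrable_powR_sub (R : realType) (T a : R) : 0 < T -> 0 < a ->
  (@lebesgue_measure R).-integrable `]0, T[ (EFin \o (fun s => (T - s) `^ (a - 1))).
Proof.
move=> T0 a0.
have mf : measurable_fun [set: R] (EFin \o (fun s => (T - s) `^ (a - 1))).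
  apply/measurable_EFinP; apply: (@measurableT_comp _ _ _ _ _ _ (fun t : R => t `^ (a - 1))).
    exact: measurable_powR.
  exact: measurable_funB.
apply/integrableP; split; first exact: measurable_funS mf.
under eq_integral do rewrite gee0_abs ?lee_fin ?powR_ge0//.
(* The shift by 2 keeps the right endpoint positive already at i = 0, as the fundamental theorem of
   calculus wants a nondegenerate interval. *)
pose F (i : nat) : set R := `[0, T - T / i.+2%:R]%classic.
have F_lt i : 0 < T - T / i.+2%:R.
  by rewrite subr_gt0 ltr_pdivrMr// ltr_pMr// ltr1n.
have FT : `]0, T[ `<=` \bigcup_i F i.
  move=> s /=; rewrite in_itv/= => /andP[s0 sT].
  have [N TN] : exists N : nat, T / (T - s) < N%:R.
    by exists (Num.bound (T / (T - s))); rewrite archi_boundP// divr_ge0 ?ltW// subr_gt0.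
  exists N => //; rewrite /F /= in_itv/= (ltW s0)/= lerBrDr -lerBrDl.
  rewrite ler_pdivrMr// mulrC -ler_pdivrMr ?subr_gt0//.
  by rewrite (le_trans (ltW TN))// ler_nat ltnW.
apply: (@le_lt_trans _ _ (\int[@lebesgue_measure R]_(s in \bigcup_i F i) ((T - s) `^ (a - 1))%:E)%E).
  apply: ge0_subset_integral => //.
  - by apply: bigcup_measurable => i _; exact: measurable_itv.
  - by apply: measurable_funS mf => //.
  - by move=> s _; rewrite lee_fin powR_ge0.
have ndF : nondecreasing_seq F.
  apply/nondecreasing_seqP => i; apply/subsetPset => s /=.
  rewrite /F /= !in_itv/= => /andP[-> /le_trans]; apply.
  by rewrite lerD2l lerN2 ler_pM2l// lef_pV2 ?posrE// ler_nat.

have mF i : measurable (F i) by exact: measurable_itv.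
have cvF : (\int[@lebesgue_measure R]_(s in F i) ((T - s) `^ (a - 1))%:E @[i --> \oo] -->
    \int[@lebesgue_measure R]_(s in \bigcup_i F i) ((T - s) `^ (a - 1))%:E)%E.
  apply: ge0_nondecreasing_set_cvg_integral => //.
  - by move=> i; exact: measurable_funS mf.
  - by move=> i s _; rewrite lee_fin powR_ge0.
rewrite -(cvg_lim _ cvF)//.
apply: (@le_lt_trans _ _ (T `^ a / a)%:E); last exact: ltry.
apply: lime_le.
  by apply/cvg_ex; eexists; exact: cvF.
apply: nearW => i; pose G (s : R) : R := - (T - s) `^ a / a.
have dG s : s < T -> is_derive s 1 G ((T - s) `^ (a - 1)).
  move=> sT; have Ts0 : 0 < T - s by rewrite subr_gt0.
  have dT : is_derive s 1 (fun s => T - s) (- 1).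
    by apply: is_derive_eq; rewrite add0r mul1r.
  have dP := @is_derive1_comp _ (fun x : R => x `^ a) (fun s => T - s) s _ _ (is_derive1_powR a Ts0) dT.
  rewrite /G.
  have -> : (fun s => - (T - s) `^ a / a) = (- a^-1) \*: ((fun x : R => x `^ a) \o (fun s => T - s)).
    by apply/funext => r /=; rewrite /GRing.scale/= mulNr mulrC mulNr.
  apply: is_derive_eq; rewrite /GRing.scale/= mulrN1 mulrNN mulrA mulVf ?mul1r//.
  by rewrite gt_eqF.
have cont s : s < T -> {for s, continuous (fun s => (T - s) `^ (a - 1))}.
  move=> sT; have Ts0 : 0 < T - s by rewrite subr_gt0.
  apply: (@continuous_comp _ _ _ (fun s => T - s) (fun x : R => x `^ (a - 1))).
    by apply: cvgB; [exact: cvg_cst|exact: cvg_id].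
  apply/differentiable_continuous/derivable1_diffP.
  by apply: ex_derive; exact: is_derive1_powR.
have iT : T - T / i.+2%:R < T by rewrite ltrBlDr ltrDl divr_gt0.
have cG s : s < T -> {for s, continuous G}.
  move=> sT; apply/differentiable_continuous/derivable1_diffP.
  by case: (dG _ sT).
rewrite /F (@continuous_FTC2 _ (fun s => (T - s) `^ (a - 1)) G) //.
- rewrite -EFinD lee_fin /G subr0 !mulNr opprK.
  rewrite addrC lerBlDr lerDl divr_ge0 ?powR_ge0//; exact: ltW.
- apply: continuous_in_subspaceT => s; rewrite inE/= in_itv/= => /andP[_ si].
  by apply: cont; exact: le_lt_trans si iT.
- split.
  + move=> s; rewrite in_itv/= => /andP[_ si].
    by case: (dG _ (lt_trans si iT)).
  + by apply: cvg_at_right_filter; exact: cG.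
  + by apply: cvg_at_left_filter; exact: cG.
- move=> s; rewrite in_itv/= => /andP[_ si].
  by rewrite derive1E; have := dG _ (lt_trans si iT); case.
Qed.

(** * Mittag-Leffler series with uniform geometric tails *)

Lemma cvg_series_half (R : realType) (a : R^nat) (C : R) :
  (forall k, `|a k| <= C * 2^-1 ^+ k) ->
  cvgn (series a) /\
  forall p, `|limn (series a) - \sum_(k < p) a k| <= 2 * C * 2^-1 ^+ p.
Proof.
move=> aC; have cs : cvgn (series a).
  apply: normed_cvg; apply: (@series_le_cvg _ _ (geometric C 2^-1)) => //.
  - by move=> k; exact: normr_ge0.
  - by move=> k; apply: le_trans (aC k).
  - by apply: is_cvg_geometric_series; rewrite ger0_norm ?invr_ge0// invf_lt1// ltr1n.
split=> // p; rewrite distrC.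
(* The right-hand side is the exact value of the geometric sum from p to p + j - 1; keeping its
   subtracted term lets the induction close. *)
have bnd j : `|\sum_(k < p) a k - series a (p + j)%N| <= 2 * C * (2^-1 ^+ p - 2^-1 ^+ (p + j)).
  rewrite /series/= big_mkord; elim: j => [|j IH].
    by rewrite addn0 !subrr normr0 mulr0.
  rewrite addnS big_ord_recr/= opprD addrA (le_trans (ler_normB _ _))//.
  rewrite (le_trans (lerD IH (aC _)))//.
  rewrite exprS; lra.
have cv : `|\sum_(k < p) a k - series a N| @[N --> \oo] --> `|\sum_(k < p) a k - limn (series a)|.
  by apply: cvg_norm; apply: cvgB; [exact: cvg_cst|exact: cs].
rewrite -(cvg_lim _ cv)//; apply: limr_le; first by apply/cvg_ex; eexists; exact: cv.
exists p => // N /= pN; rewrite -(subnKC pN) (le_trans (bnd _))//.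
have C0 : 0 <= C by have := le_trans (normr_ge0 _) (aC 0%N); rewrite expr0 mulr1.
by rewrite ler_wpM2l ?mulr_ge0// gerBl exprn_ge0.
Qed.

Lemma normr_expmx_le (R : realType) (n : nat) (M : 'M[R]_n) (r : R) :
  (forall i j, `|M i j| <= r) ->
  forall k i j, `|(M ^+ k) i j| <= (n%:R * r) ^+ k.
Proof.
move=> Mr; elim=> [|k IH] i j; first by rewrite !expr0 mxE; case: (_ == _); rewrite ?normr1 ?normr0.
rewrite !exprS -mulmxE mxE (le_trans (ler_norm_sum _ _ _))//.
apply: (@le_trans _ _ (\sum_(l < n) r * (n%:R * r) ^+ k)).
  by apply: ler_sum => l _; rewrite normrM ler_pM.
by rewrite sumr_const card_ord -mulrA [n%:R * (_ * _)]mulr_natl.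
Qed.

(** A matrix entourage constrains finitely many entries, and filters are stable under finite
    intersections. *)
Lemma cvg_mx_entries (R : realType) (p q : nat) (u : nat -> 'M[R]_(p, q)) (L : 'M[R]_(p, q)) :
  (forall i j, u N i j @[N --> \oo] --> L i j) -> u N @[N --> \oo] --> L.
Proof.
move=> uL; apply/cvg_mx_entourageP => A eA.
apply: (@filter_forall _ _ (fun i (N : 'M[R]_(p, q)) => forall j, (L i j, N i j) \in A)) => i.
apply: (@filter_forall _ _ (fun j (N : 'M[R]_(p, q)) => (L i j, N i j) \in A)) => j.
have /cvg_entourageP/(_ _ eA) := uL i j.
move=> LA; have {}LA : \forall N \near \oo, A (L i j, u N i j) := LA.
suff : \forall N \near \oo, (L i j, u N i j) \in A by [].
by apply: filterS LA => N; rewrite inE.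
Qed.

(** Entries of M^k grow at most like (n r)^k. The decay ratio q = 1 / (2 (n r + 1)) absorbs this
    growth and leaves 2^-k; the summand 1 covers n r = 0. [C] is fixed before [M], hence the
    uniformity over all matrices with entries bounded by r. *)
Lemma mittag_leffler_tail (R : realType) (n : nat) (alpha beta r : R) :
  0 < alpha -> 0 <= beta -> 0 <= r ->
  exists2 C : R, 0 <= C & forall M : 'M[R]_n, (forall i j, `|M i j| <= r) ->
    forall i j,
    (\sum_(k < N) (Gamma (alpha * k%:R + beta))^-1 * (M ^+ k) i j)
      @[N --> \oo] --> mittag_leffler alpha beta M i j /\
    forall p, `|mittag_leffler alpha beta M i j -
       \sum_(k < p) (Gamma (alpha * k%:R + beta))^-1 * (M ^+ k) i j| <= C * 2^-1 ^+ p.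
Proof.
move=> a0 b0 r0; pose q : R := (2 * (n%:R * r + 1))^-1.
have nr1 : 0 < n%:R * r + 1 by rewrite ltr_wpDl// mulr_ge0.
have q0 : 0 < q by rewrite invr_gt0 mulr_gt0.
have [C C0 GC] := invr_Gamma_geometric R alpha beta q a0 b0 q0.
exists (2 * C); first by rewrite mulr_ge0.
move=> M Mr.
pose g k := (Gamma (alpha * k%:R + beta))^-1.
have aC i j k : `|g k * (M ^+ k) i j| <= C * 2^-1 ^+ k.
  rewrite normrM (le_trans (ler_pM _ _ (GC k) (normr_expmx_le R n M r Mr k i j)))//.
  rewrite -mulrA ler_wpM2l// -exprMn lerXn2r// ?nnegrE ?invr_ge0//.
    by rewrite mulr_ge0 ?mulr_ge0 ?invr_ge0// mulr_ge0 ?ltW.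
  by rewrite /q invfM -mulrA ler_piMr ?invr_ge0// mulrC ler_pdivrMr// mul1r lerDl.
(* [mittag_leffler] is a limit in the space of matrices; since that space is Hausdorff, it can be
   computed entry by entry. *)
have cvM : mittag_leffler alpha beta M =
    \matrix_(i, j) limn (series (fun k => g k * (M ^+ k) i j)).
  apply: cvg_lim; first exact: norm_hausdorff.
  apply: cvg_mx_entries => i j; rewrite mxE.
  have [cs _] := cvg_series_half R _ _ (aC i j).
  rewrite (_ : (fun N => _) = series (fun k => g k * (M ^+ k) i j))//.
  apply/funext => N; rewrite /series/= summxE; apply: eq_bigr => k _.
  by rewrite mxE.
move=> i j; have [cs tl] := cvg_series_half R _ _ (aC i j).
rewrite cvM mxE; split => //.
rewrite (_ : (fun N => _) = series (fun k => g k * (M ^+ k) i j))//.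
by apply/funext => N; rewrite /series/= big_mkord.
Qed.

(** * Expansion of the reachable states *)

(** This serves both for the singular kernel on the time interval and for the step functions on the
    parameter space. *)
Lemma integrable_mulr_bounded {d} {X : measurableType d} (R : realType)
    (mu : {measure set X -> \bar R}) (D : set X) (w f : X -> R) (c : R) :
  measurable D -> (forall x, D x -> 0 <= w x) -> mu.-integrable D (EFin \o w) ->
  measurable_fun D f -> 0 <= c -> {ae mu, forall x, D x -> `|f x| <= c} ->
  mu.-integrable D (EFin \o (fun x => w x * f x)) /\
  `|\int[mu]_(x in D) (w x * f x)| <= c * \int[mu]_(x in D) w x.
Proof.
move=> mD w0 iw mf c0 fc.
have icw : mu.-integrable D (EFin \o (fun x => c * w x)).
  by rewrite (_ : _ \o _ = (fun x => c%:E * (EFin \o w) x)%E)//; exact: integrableZl.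
have mwf : measurable_fun D (fun x => w x * f x).
  by apply: measurable_funM => //; apply/measurable_EFinP; exact: (measurable_int mu).
have wfc : (\int[mu]_(x in D) `|(w x * f x)%:E| <= \int[mu]_(x in D) (c * w x)%:E)%E.
  apply: ae_ge0_le_integral => //.
  - by apply: measurableT_comp => //; exact/measurable_EFinP.
  - by move=> x Dx; rewrite lee_fin mulr_ge0// w0.
  - exact: (measurable_int mu).
  - apply: filterS fc => x fc Dx; rewrite lee_fin normrM ger0_norm ?w0//.
    by rewrite mulrC ler_wpM2r ?w0 ?fc.
have iwf : mu.-integrable D (EFin \o (fun x => w x * f x)).
  apply/integrableP; split; first exact/measurable_EFinP.
  apply: le_lt_trans wfc _.
  by rewrite ltey_eq (integrable_fin_num mD icw).
split=> //; rewrite -RintegralZl//.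
apply: (le_trans (le_normr_Rintegral _ _)) => //.
apply: fine_le => //.
- by have := integrable_norm iwf; exact: integrable_fin_num.
- exact: (integrable_fin_num mD icw).
Qed.

Lemma Rintegral_lincomb {d} {X : measurableType d} (R : realType)
    (mu : {measure set X -> \bar R}) (D : set X) (I : Type) (r : seq I)
    (c : I -> R) (f : I -> X -> R) :
  measurable D -> (forall i, mu.-integrable D (EFin \o f i)) ->
  mu.-integrable D (EFin \o (fun x => \sum_(i <- r) c i * f i x)) /\
  \int[mu]_(x in D) (\sum_(i <- r) c i * f i x) =
    \sum_(i <- r) c i * \int[mu]_(x in D) f i x.
Proof.
move=> mD fi; elim: r => [|i r [IH1 IH2]].
  have -> : (fun x => \sum_(j <- [::]) c j * f j x) = cst 0.
    by apply/funext => x; rewrite big_nil.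
  by split; [exact: integrable0|rewrite big_nil Rintegral_cst// mul0r].
have ic : mu.-integrable D (EFin \o (fun x => c i * f i x)).
  by rewrite (_ : _ \o _ = (fun x => (c i)%:E * (EFin \o f i) x)%E)//; exact: integrableZl.
have -> : (fun x => \sum_(j <- i :: r) c j * f j x) =
    (fun x => c i * f i x + \sum_(j <- r) c j * f j x).
  by apply/funext => x; rewrite big_cons.
split; last by rewrite RintegralD// IH2 RintegralZl// big_cons.
rewrite (_ : _ \o _ = ((EFin \o (fun x => c i * f i x)%R) \+
   (EFin \o (fun x => \sum_(i <- r) c i * f i x)%R))%E)//.
exact: integrableD.
Qed.

Lemma exprZ_mx (R : realType) (n : nat) (c : R) (A : 'M[R]_n) k :
  (c *: A) ^+ k = c ^+ k *: A ^+ k.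
Proof.
elim: k => [|k IH]; first by rewrite !expr0 scale1r.
by rewrite !exprS IH -!mulmxE -scalemxAl -scalemxAr scalerA.
Qed.

Lemma measurable_powR_sub (R : realType) (T a : R) (D : set R) :
  measurable_fun D (fun s : R => (T - s) `^ a).
Proof.
apply: (@measurable_funS _ _ _ _ setT) => //.
apply: (@measurableT_comp _ _ _ _ _ _ (fun t : R => t `^ a)).
  exact: measurable_powR.
exact: measurable_funB.
Qed.

(** Truncating the kernel series under the integral separates the variables: v_(k,l) is the integral
    of (T - s)^(alpha - 1 + alpha k) u_l(s) / Gamma(alpha k + alpha), which depends on the control
    alone. Therefore [v] is chosen before [A] and [B], and [C] even before [u]. *)
Lemma solution_tail (R : realType) (n m : nat) (alpha T a b : R) :
  0 < alpha -> 0 < T -> 0 <= a -> 0 <= b ->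
  exists2 C : R, 0 <= C & forall (N : R) (u : R -> 'cV[R]_m), 0 <= N ->
    (forall l, measurable_fun `]0, T[ (fun s => u s l 0)) ->
    {ae lebesgue_measure, forall s, (`]0, T[%classic : set R) s -> forall l, `|u s l 0| <= N} ->
  exists v : nat -> 'I_m -> R,
  forall (A : 'M[R]_n) (B : 'M[R]_(n, m)),
    (forall i j, `|A i j| <= a) -> (forall i j, `|B i j| <= b) ->
  forall i p,
    `|solution alpha A B 0 u T i 0 -
      \sum_(kl : 'I_p * 'I_m) (A ^+ kl.1 *m B) i kl.2 * v kl.1 kl.2| <= C * N * 2^-1 ^+ p.
Proof.
move=> a0 T0 ap bp.
pose r := T `^ alpha * a.
have FF : Filter (almost_everywhere (@lebesgue_measure R)).
  exact: (ae_filter_ringOfSetsType lebesgue_measure).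
have r0 : 0 <= r by rewrite mulr_ge0 ?powR_ge0.
have [C C0 HC] := mittag_leffler_tail R n alpha alpha r a0 (ltW a0) r0.
pose w (s : R) := (T - s) `^ (alpha - 1).
pose D : set R := `]0, T[%classic.
have mD : measurable D by exact: measurable_itv.
have w0 s : D s -> 0 <= w s by rewrite powR_ge0.
have iw : (@lebesgue_measure R).-integrable D (EFin \o w) by exact: integrable_powR_sub.
pose K := \int[@lebesgue_measure R]_(s in D) w s.
have K0 : 0 <= K by exact: Rintegral_ge0.
(* n and m count the terms of the products by [B] and by [u], C b bounds a kernel tail entry times
   an entry of [B], and [K] is the mass of the weight. *)
exists (m%:R * (n%:R * (C * b)) * K); first by rewrite !mulr_ge0.
move=> N u N0 mu ub.
pose g k := (Gamma (alpha * k%:R + alpha))^-1.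
pose t (s : R) := (T - s) `^ alpha.
have t0 s : 0 <= t s by exact: powR_ge0.
have tT s : D s -> t s <= T `^ alpha.
  rewrite /D/= in_itv/= => /andP[s0 sT]; apply: ge0_ler_powR; rewrite ?nnegrE ?(ltW a0) ?(ltW T0)//.
    by rewrite subr_ge0 ltW.
  by rewrite gerBl ltW.
have mt : measurable_fun D t by exact: measurable_powR_sub.
pose f k l s := g k * t s ^+ k * u s l 0.
exists (fun k l => \int[@lebesgue_measure R]_(s in D) (w s * f k l s)).
move=> A B Aa Bb i p.
have if_ (kl : 'I_p * 'I_m) :
    (@lebesgue_measure R).-integrable D (EFin \o (fun s => w s * f kl.1 kl.2 s)).
  have mf : measurable_fun D (f kl.1 kl.2).
    apply: measurable_funM => //; apply: measurable_funM => //.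
    exact: measurable_funX.
  have fb : {ae lebesgue_measure, forall s, D s ->
      `|f kl.1 kl.2 s| <= `|g kl.1| * (T `^ alpha) ^+ kl.1 * N}.
    apply: filterS ub => s us Ds; rewrite !normrM ler_pM ?mulr_ge0 ?us//.
    by rewrite ler_wpM2l// ger0_norm ?exprn_ge0// lerXn2r ?nnegrE ?powR_ge0// tT.
  have := integrable_mulr_bounded R lebesgue_measure D w (f kl.1 kl.2) _ mD w0 iw mf _ fb.
  by case=> //; rewrite !mulr_ge0 ?exprn_ge0 ?powR_ge0.
pose E s : 'M[R]_n := mittag_leffler alpha alpha (t s *: A).
have tA s : D s -> forall i j, `|(t s *: A) i j| <= r.
  by move=> Ds j k; rewrite mxE normrM ger0_norm// ler_pM// tT.
(* The kernel is a pointwise limit of polynomials in [t s], whence its measurability. *)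
have mE j : measurable_fun D (fun s => E s i j).
  apply: (@measurable_fun_cvg _ _ _ D
    (fun N s => \sum_(k < N) g k * ((t s *: A) ^+ k) i j)); last first.
    by move=> s Ds; have [] := HC _ (tA _ Ds) i j.
  move=> M; apply: measurable_sum => k; apply: measurable_funM => //.
  under eq_fun do rewrite exprZ_mx mxE.
  by apply: measurable_funM => //; exact: measurable_funX.
pose F s := (E s *m B *m u s) i 0.
have mF : measurable_fun D F.
  rewrite /F; under eq_fun do rewrite mxE.
  apply: measurable_sum => l; apply: measurable_funM => //.
  under eq_fun do rewrite mxE.
  by apply: measurable_sum => h; apply: measurable_funM.
pose P s := \sum_(kl : 'I_p * 'I_m) (A ^+ kl.1 *m B) i kl.2 * f kl.1 kl.2 s.
have mP : measurable_fun D P.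
  apply: measurable_sum => kl; apply: measurable_funM => //.
  apply: measurable_funM => //; apply: measurable_funM => //.
  exact: measurable_funX.
have FP : {ae lebesgue_measure, forall s, D s ->
    `|F s - P s| <= m%:R * (n%:R * (C * b)) * N * 2^-1 ^+ p}.
  apply: filterS ub => s us; move: us.
  move=> /[swap] Ds /(_ Ds) us; pose e h := E s i h - \sum_(k < p) g k * ((t s *: A) ^+ k) i h.
  have eC h : `|e h| <= C * 2^-1 ^+ p by have [_] := HC _ (tA _ Ds) i h; exact.
  (* [P] is [F] with the kernel truncated at order p, so the difference is linear in the tail
     [e]. *)
  have -> : F s - P s = \sum_(l < m) (\sum_(h < n) e h * B h l) * u s l 0.
    have -> : P s = \sum_(l < m) (\sum_(h < n)
        (\sum_(k < p) g k * ((t s *: A) ^+ k) i h) * B h l) * u s l 0.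
      rewrite /P -(pair_bigA _ (fun (k : 'I_p) l => (A ^+ k *m B) i l * f k l s))/=.
      rewrite exchange_big/=; apply: eq_bigr => l _.
      under [in RHS]eq_bigr do rewrite mulr_suml.
      rewrite [in RHS]exchange_big/= mulr_suml; apply: eq_bigr => k _.
      rewrite mxE !mulr_suml; apply: eq_bigr => h _.
      by rewrite exprZ_mx mxE /f; ring.
    rewrite /F mxE -sumrB; apply: eq_bigr => l _.
    rewrite -mulrBl mxE -sumrB; congr (_ * _); apply: eq_bigr => h _.
    by rewrite -mulrBl.
  rewrite (le_trans (ler_norm_sum _ _ _))//.
  apply: (@le_trans _ _ (\sum_(l < m) (n%:R * (C * 2^-1 ^+ p * b)) * N)).
    apply: ler_sum => l _; rewrite normrM ler_pM//.
    rewrite (le_trans (ler_norm_sum _ _ _))//.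
    apply: (@le_trans _ _ (\sum_(h < n) C * 2^-1 ^+ p * b)).
      by apply: ler_sum => h _; rewrite normrM ler_pM.
    by rewrite sumr_const card_ord [X in _ <= X]mulr_natl.
  rewrite sumr_const card_ord -[X in X <= _]mulr_natl.
  by rewrite le_eqVlt; apply/orP; left; apply/eqP; ring.
have c0 : 0 <= m%:R * (n%:R * (C * b)) * N * 2^-1 ^+ p.
  by rewrite !mulr_ge0 ?exprn_ge0.
have [iwFP wFP] := integrable_mulr_bounded R lebesgue_measure D w (fun s => F s - P s) _
  mD w0 iw (measurable_funB mF mP) c0 FP.
have -> : solution alpha A B 0 u T i 0 = \int[@lebesgue_measure R]_(s in D) (w s * F s).
  rewrite /solution mulmx0 add0r mxE.
  by apply: eq_Rintegral => s _; rewrite mxE.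
have [iPs wP] := Rintegral_lincomb R lebesgue_measure D _ (index_enum ('I_p * 'I_m)%type)
  (fun kl => (A ^+ kl.1 *m B) i kl.2) (fun kl s => w s * f kl.1 kl.2 s) mD if_.
rewrite -wP.
have -> : \int[@lebesgue_measure R]_(s in D) (w s * F s) =
   \int[@lebesgue_measure R]_(s in D) (w s * (F s - P s)) + \int[@lebesgue_measure R]_(s in D)
     (\sum_(kl : 'I_p * 'I_m) (A ^+ kl.1 *m B) i kl.2 * (w s * f kl.1 kl.2 s)).
  rewrite -RintegralD//.
  apply: eq_Rintegral => s _; rewrite mulrBr /P mulr_sumr.
  under [in X in _ - X]eq_bigr do rewrite mulrCA.
  by rewrite subrK.
rewrite addrK (le_trans wFP)//.
by rewrite -/K [X in X <= _]mulrC !mulrA [K * _ * _]mulrC !mulrA; lra.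
Qed.

(** * Atoms and disjoint sets of positive measure *)

(** Each level q satisfies q <= f almost everywhere on [G] or f < q almost everywhere on [G]. The
    constant is the supremum of the levels of the first kind. *)
Lemma ae_cst_on_atom {d} {S : measurableType d} (R : realType)
    (mu : {measure set S -> \bar R}) (G : set S) (f : S -> R) :
  (forall H, measurable H ->
    {ae mu, forall s, G s -> H s} \/ {ae mu, forall s, G s -> ~ H s}) ->
  measurable_fun setT f ->
  exists c, {ae mu, forall s, G s -> f s = c}.
Proof.
move=> aG mf; pose Q := [set q | {ae mu, forall s, G s -> q <= f s}].
have QN q : ~ Q q -> {ae mu, forall s, G s -> f s < q}.
  move=> nQ; have mH : measurable [set s | q <= f s].
    by rewrite -[X in measurable X]setTI; exact: measurable_fun_le.
  have [/nQ[]|] := aG _ mH.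
  by apply: filterS => s /[apply] /negP; rewrite -ltNge.
(* If [Q] is empty or unbounded above, then f lies below every -n, or above every n, almost
   everywhere on [G]. So [G] is null and the value 0 is arbitrary. *)
have [Q0|Q0] := pselect (Q !=set0); last first.
  exists 0; have /ae_foralln : forall n : nat, {ae mu, forall s, G s -> f s < - n%:R}.
    by move=> n; apply: QN => Qn; apply: Q0; exists (- n%:R).
  apply: filterS => s fs Gs; have := fs (Num.bound `|f s|) Gs.
  by rewrite ltrNr ltNge -normrN (le_trans (ler_norm _))// normrN ltW// archi_boundP.
have [Qb|Qb] := pselect (has_ubound Q); last first.
  exists 0; have /ae_foralln : forall n : nat, {ae mu, forall s, G s -> n%:R <= f s}.
    move=> n; have [q Qq nq] : exists2 q, Q q & n%:R <= q.
      apply: contrapT => nQ; apply: Qb; exists n%:R => q Qq.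
      by rewrite leNgt; apply/negP => /ltW nq; apply: nQ; exists q.
    by apply: filterS Qq => s /[apply]; exact: le_trans.
  apply: filterS => s fs Gs; have := fs (Num.bound `|f s|) Gs.
  by rewrite leNgt (le_lt_trans (ler_norm _))// archi_boundP.
exists (sup Q).
have lo : {ae mu, forall s, forall n : nat, G s -> sup Q - n.+1%:R^-1 <= f s}.
  apply/ae_foralln => n.
  have [q Qq qs] : exists2 q, Q q & sup Q - n.+1%:R^-1 < q.
    by apply: sup_adherent => //; rewrite invr_gt0.
  by apply: filterS Qq => s /[apply]; exact: le_trans (ltW qs).
have hi : {ae mu, forall s, forall n : nat, G s -> f s < sup Q + n.+1%:R^-1}.
  apply/ae_foralln => n; apply: QN => /(sup_upper_bound (conj Q0 Qb)).
  by rewrite leNgt ltrDl invr_gt0 ltr0n.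
apply: filterS2 lo hi => s lo hi Gs.
apply/eqP; rewrite eq_le; apply/andP; split.
  apply/ler_addgt0Pr => e e0; have [n ne] : exists n : nat, n.+1%:R^-1 < e.
    by have [n] := ltr_add_invr e0; rewrite add0r; exists n.
  by rewrite (le_trans (ltW (hi n Gs)))// lerD2l ltW.
apply/ler_addgt0Pr => e e0; have [n ne] : exists n : nat, n.+1%:R^-1 < e.
  by have [n] := ltr_add_invr e0; rewrite add0r; exists n.
by rewrite -lerBlDr (le_trans _ (lo n Gs))// lerD2l lerN2 ltW.
Qed.

(* Equivalently, F is up to a null set a finite union of atoms. *)
Definition finitely_generated_on {d} {S : measurableType d} (R : realType)
    (mu : {measure set S -> \bar R}) (F : set S) : Prop :=
  exists (I : finType) (G : I -> set S), (forall i, measurable (G i)) /\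
    forall f : S -> R, measurable_fun setT f -> exists c : I -> R,
      {ae mu, forall s, F s -> f s = \sum_i c i * \1_(G i) s}.

(** Generators of one piece may spill over into the other; cutting them with [H] or its complement
    keeps the two sums from interfering. *)
Lemma finitely_generated_on_split {d} {S : measurableType d} (R : realType)
    (mu : {measure set S -> \bar R}) (F H : set S) : measurable H ->
  finitely_generated_on R mu (F `&` H) -> finitely_generated_on R mu (F `\` H) ->
  finitely_generated_on R mu F.
Proof.
move=> mH [I1 [G1 [mG1 fG1]]] [I2 [G2 [mG2 fG2]]].
exists (I1 + I2)%type, (fun i => match i with inl j => G1 j `&` H | inr j => G2 j `\` H end).
split; first by case=> j; [exact: measurableI|exact: measurableD].
move=> f mf; have [c1 f1] := fG1 f mf; have [c2 f2] := fG2 f mf.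
exists (fun i => match i with inl j => c1 j | inr j => c2 j end).
apply: filterS2 f1 f2 => s f1 f2 Fs; rewrite big_sumType/=.
have [Hs|nHs] := pselect (H s).
  rewrite f1// [X in _ + X]big1 ?addr0 => [|j _]; last first.
    by rewrite indicE memNset ?mulr0// => -[].
  by apply: eq_bigr => j _; rewrite !indicE in_setI (mem_set Hs) andbT.
rewrite f2// [X in X + _]big1 ?add0r => [|j _]; last first.
  by rewrite indicE memNset ?mulr0// => -[].
by apply: eq_bigr => j _; rewrite !indicE in_setD (memNset nHs) andbT.
Qed.

(** Some [H] cuts [F] into two non-null pieces, at least one of which is again not finitely
    generated. That one is kept, and the other supplies the positive measure. *)
Lemma not_finitely_generated_shrink {d} {S : measurableType d} (R : realType)
    (mu : {measure set S -> \bar R}) (F : set S) :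
  measurable F -> ~ finitely_generated_on R mu F ->
  exists F', [/\ measurable F', F' `<=` F, ~ finitely_generated_on R mu F' &
    (0 < mu (F `\` F'))%E].
Proof.
move=> mF nF.
have [H [mH nH1 nH2]] : exists H, [/\ measurable H, ~ {ae mu, forall s, F s -> H s} &
    ~ {ae mu, forall s, F s -> ~ H s}].
  (* Without such a cut every measurable function would be almost everywhere constant on [F], and
     the indicator of [F] would generate. *)
  apply: contrapT => nH; apply: nF; exists unit, (fun=> F); split=> // f mf.
  have [|c fc] := ae_cst_on_atom R mu F f _ mf.
    move=> H mH; have [|n1] := pselect {ae mu, forall s, F s -> H s}; first by left.
    have [|n2] := pselect {ae mu, forall s, F s -> ~ H s}; first by right.
    by exfalso; apply: nH; exists H.
  exists (fun=> c); apply: filterS fc => s fc Fs.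
  by rewrite big_const card_unit/= addr0 indicE (mem_set Fs) mulr1 fc.
have pos D : measurable D -> ~ {ae mu, forall s, ~ D s} -> (0 < mu D)%E.
  move=> mD nD; rewrite lt0e measure_ge0 andbT; apply/eqP => D0; apply: nD.
  by exists D; split => // s /= /contrapT.
have [FH|FH] := pselect (finitely_generated_on R mu (F `&` H)).
  exists (F `\` H); split.
  - exact: measurableD.
  - by move=> s [].
  - by move=> FH'; apply: nF; exact: finitely_generated_on_split FH FH'.
  - apply: pos; first by apply: measurableD => //; exact: measurableD.
    move=> a; apply: nH2; apply: filterS a => s /= a Fs Hs; apply: a.
    by split=> // -[].
exists (F `&` H); split => //.
- exact: measurableI.
- apply: pos; first by apply: measurableD => //; exact: measurableI.
  move=> a; apply: nH1; apply: filterS a => s /= a Fs.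
  by apply: contrapT => nHs; apply: a; split => // -[].
Qed.

(** Shrinking repeatedly from the whole space gives a decreasing sequence, whose successive
    differences are the required sets. *)
Lemma disjoint_positive_sets {d} {S : measurableType d} (R : realType)
    (mu : {measure set S -> \bar R}) :
  ~ finitely_generated_on R mu setT ->
  exists E : nat -> set S, [/\ forall i, measurable (E i),
    forall i j s, E i s -> E j s -> i = j & forall i, (0 < mu (E i))%E].
Proof.
move=> nT; pose X := {F : set S | measurable F /\ ~ finitely_generated_on R mu F}.
pose r (F F' : X) := sval F' `<=` sval F /\ (0 < mu (sval F `\` sval F'))%E.
have step (F : X) : {F' : X | r F F'}.
  apply: cid; case: F => F [mF nF].
  have [F' [mF' F'F nF' F'0]] := not_finitely_generated_shrink R mu F mF nF.
  by exists (exist _ F' (conj mF' nF')).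
have [F [_ rF]] := dependent_choice step (exist _ setT (conj measurableT nT)).
have sub i j : (i <= j)%N -> sval (F j) `<=` sval (F i).
  move=> /subnKC <-; elim: (j - i)%N => [|k IH]; first by rewrite addn0.
  by rewrite addnS => s Fs; apply: IH; have [+ _] := rF (i + k)%N; apply.
have dis i j s : (i < j)%N -> (sval (F i) `\` sval (F i.+1)) s ->
    ~ (sval (F j) `\` sval (F j.+1)) s.
  by move=> ij [_ nF] [Fj _]; apply: nF; exact: sub Fj.
exists (fun i => sval (F i) `\` sval (F i.+1)); split.
- by move=> i; apply: measurableD; [case: (svalP (F i))|case: (svalP (F i.+1))].
- move=> i j s Ei Ej; case: (ltngtP i j) => // ij.
    by have := dis _ _ _ ij Ei.
  by have := dis _ _ _ ij Ej.
- by move=> i; have [] := rF i.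
Qed.

(** * Matrix-valued Lebesgue spaces *)

Lemma measurable_euclidean_norm {d} {X : measurableType d} (R : realType) (p q : nat)
    (D : set X) (f : X -> 'M[R]_(p, q)) :
  mx_measurable_fun D f -> measurable_fun D (fun x => euclidean_norm (f x)).
Proof.
move=> mf; apply: (@measurableT_comp _ _ _ _ _ _ (@Num.sqrt R)).
  by apply: continuous_measurable_fun; exact: sqrt_continuous.
by apply: measurable_sum => i; apply: measurable_sum => j; apply: measurable_funX; exact: mf.
Qed.

Lemma normr_entry_le_euclidean_norm (R : realType) (p q : nat) (M : 'M[R]_(p, q)) i j :
  `|M i j| <= euclidean_norm M.
Proof.
rewrite -sqrtr_sqr ler_wsqrtr// (bigD1 i)//= (bigD1 j)//= -addrA lerDl addr_ge0//.
  by apply: sumr_ge0 => k _; exact: sqr_ge0.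
by apply: sumr_ge0 => k _; apply: sumr_ge0 => l _; exact: sqr_ge0.
Qed.

Lemma mxLpy_ae_bounded {d} {X : measurableType d} (R : realType)
    (mu : {measure set X -> \bar R}) (p q : nat) (D : set X) (f : X -> 'M[R]_(p, q)) :
  (0 < mu setT)%E -> mxLp mu +oo%E D f ->
  exists2 a : R, 0 <= a & {ae mu, forall x, D x -> forall i j, `|f x i j| <= a}.
Proof.
(* The norm of exponent +oo is an essential supremum only if the whole space has positive measure;
   [mu0] selects that case. *)
move=> mu0 [_]; rewrite /finite_norm unlock mu0 => /ess_supr_bounded[M fM].
exists `|M| => //; apply: filterS fM => x /= fM Dx i j.
rewrite (le_trans (normr_entry_le_euclidean_norm _ _ _ _ _ _))//.
rewrite (le_trans (ler_norm _))// (le_trans _ (ler_norm _))//.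
by move: fM; rewrite patchE mem_set.
Qed.

Lemma bounded_mxL2 {d} {X : measurableType d} (R : realType)
    (mu : {measure set X -> \bar R}) (p q : nat) (f : X -> 'M[R]_(p, q)) (c : R) :
  (mu setT < +oo)%E -> mx_measurable_fun setT f -> (forall x i j, `|f x i j| <= c) ->
  mxLp mu 2%:E setT f.
Proof.
move=> muT mf fc; split => //; rewrite /finite_norm unlock poweR_lty// patch_setT.
pose M := Num.sqrt (\sum_(i < p) \sum_(j < q) c ^+ 2).
have mn := measurable_euclidean_norm R _ _ _ _ mf.
apply: (@le_lt_trans _ _ (\int[mu]_x (M `^ 2)%:E)%E); last first.
  by rewrite integral_cst// lte_mul_pinfty ?lee_fin ?powR_ge0.
apply: ge0_le_integral => //=.
- apply/measurable_EFinP; apply: (@measurableT_comp _ _ _ _ _ _ (fun t : R => t `^ 2)).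
    exact: measurable_powR.
  exact: measurableT_comp.
- move=> x _; rewrite lee_fin ge0_ler_powR ?nnegrE ?sqrtr_ge0//.
  rewrite ger0_norm ?sqrtr_ge0// ler_wsqrtr//.
  apply: ler_sum => i _; apply: ler_sum => j _.
  by rewrite -real_normK ?num_real// lerXn2r ?nnegrE// (le_trans _ (fc x i j)).
Qed.

(** If the indicators of the [G i] generated all measurable functions, their products with the basis
    vectors would be finitely many bounded functions spanning L^2. *)
Lemma infinite_dimensional_L2_not_finitely_generated {d} {S : measurableType d}
    (R : realType) (mu : probability S R) (n : nat) :
  infinite_dimensional_L2 mu n -> ~ finitely_generated_on R mu setT.
Proof.
move=> inf [I [G [mG fG]]]; apply: inf.
have muT : (mu setT < +oo)%E by rewrite probability_setT ltry.
pose J := (I * 'I_n)%type.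
pose e (ij : J) (s : S) : 'cV[R]_n := \1_(G ij.1) s *: delta_mx ij.2 0.
exists #|{: J}|, (fun k => e (enum_val k)); split.
  move=> k; apply: (bounded_mxL2 R mu _ _ _ 1 muT).
    move=> i j; under eq_fun do rewrite mxE.
    by apply: measurable_funM => //; exact: measurable_indic.
  move=> s i j; rewrite !mxE normrM indicE !normr_nat.
  by case: (_ \in _); case: (_ && _); rewrite ?mulr1 ?mulr0.
move=> x [mx _].
have /choice[c xc] (j : 'I_n) : exists c : I -> R,
  {ae mu, forall s, setT s -> x s j 0 = \sum_i c i * \1_(G i) s}.
  exact: fG.
exists (fun k => c (enum_val k).2 (enum_val k).1).
have : {ae mu, forall s, forall j, setT s -> x s j 0 = \sum_i c j i * \1_(G i) s}.
  exact: filter_forall.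
apply: filterS => s xs.
rewrite -(big_enum_val (fun ij : J => c ij.2 ij.1 *: e ij s)).
rewrite -(pair_bigA _ (fun i j => c j i *: e (i, j) s))/=.
apply/matrixP => j k; rewrite ord1 xs// summxE; apply: eq_bigr => i _.
rewrite summxE (bigD1 j)//= big1 ?addr0 => [|l lj].
  by rewrite !mxE !eqxx mulr1.
by rewrite !mxE eq_sym (negbTE lj) !mulr0.
Qed.

(** * Tools for building the unreachable target *)

(** A matrix with more rows than columns has a nonzero left kernel. *)
Lemma nontrivial_relation (R : realType) (I J : finType) (W : I -> J -> R) :
  (#|J| < #|I|)%N ->
  exists xi : I -> R, (exists i, xi i != 0) /\ forall j, \sum_i xi i * W i j = 0.
Proof.
move=> JI; pose M : 'M[R]_(#|I|, #|J|) := \matrix_(i, j) W (enum_val i) (enum_val j).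
have : kermx M != 0.
  rewrite kermx_eq0 /row_free neq_ltn; apply/orP; left.
  by rewrite (leq_ltn_trans (rank_leq_col _)).
move=> /rowV0Pn[v /sub_kermxP vM v0].
exists (fun i => v 0 (enum_rank i)); split.
  move/rV0Pn : v0 => [i vi]; exists (enum_val i); by rewrite enum_valK.
move=> j; move/matrixP : vM => /(_ 0 (enum_rank j)); rewrite !mxE => vMj; rewrite -[RHS]vMj.
rewrite (reindex _ (onW_bij _ (enum_val_bij I)))/=. apply: eq_bigr => i _.
by rewrite enum_valK mxE enum_rankK.
Qed.

Lemma piecewise_constant {d} {S : measurableType d} (R : realType)
    (E : nat -> set S) (z : nat -> R) (c : R) :
  0 <= c -> (forall i, `|z i| <= c) ->
  (forall i, measurable (E i)) -> (forall i j s, E i s -> E j s -> i = j) ->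
  exists y : S -> R, [/\ measurable_fun setT y, forall s, `|y s| <= c &
    forall i s, E i s -> y s = z i].
Proof.
move=> c0 zc mE tE.
pose y s := if pselect (exists i, E i s) is left e then z (projT1 (cid e)) else 0.
have yE i s : E i s -> y s = z i.
  rewrite /y => Es; case: pselect => [e|[]]; last by exists i.
  by case: cid => j /= Ej; rewrite (tE _ _ _ Es Ej).
exists y; split => //; last first.
  by move=> s; rewrite /y; case: pselect => [e|_]; rewrite ?normr0.
rewrite -(setUv (\bigcup_i E i)).
apply/measurable_funU; [exact: bigcupT_measurable|exact/measurableC/bigcupT_measurable|].
split.
  apply/measurable_fun_bigcup => // i.
  apply: (eq_measurable_fun (cst (z i))) => [s /[!inE] Es|]; last exact: measurable_cst.
  by rewrite (yE i).
apply: (eq_measurable_fun (cst (0 : R))) => [s /[!inE] nE|]; last exact: measurable_cst.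
rewrite /y; case: pselect => // -[i Ei]; exfalso; apply: nE; by exists i.
Qed.

Lemma mx_measurable_mulmx {d} {X : measurableType d} (R : realType) (p q r : nat)
    (D : set X) (f : X -> 'M[R]_(p, q)) (g : X -> 'M[R]_(q, r)) :
  mx_measurable_fun D f -> mx_measurable_fun D g ->
  mx_measurable_fun D (fun x => f x *m g x).
Proof.
move=> mf mg i j; under eq_fun do rewrite mxE.
by apply: measurable_sum => k; apply: measurable_funM; [exact: mf|exact: mg].
Qed.

Lemma mx_measurable_expr {d} {X : measurableType d} (R : realType) (n : nat)
    (D : set X) (f : X -> 'M[R]_n) k :
  mx_measurable_fun D f -> mx_measurable_fun D (fun x => f x ^+ k).
Proof.
move=> mf; elim: k => [|k IH].
  by move=> i j; under eq_fun do rewrite expr0; exact: measurable_cst.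
rewrite (_ : (fun x => _) = (fun x => f x *m f x ^+ k)); last first.
  by apply/funext => x; rewrite exprS mulmxE.
exact: mx_measurable_mulmx.
Qed.

(** * Contradiction from a control reaching the target *)

Theorem proposition4p8 (R : realType) (d : measure_display)
    (S : measurableType d) (mu : probability S R) (alpha T : R) (n m : nat)
    (A : S -> 'M[R]_n) (B : S -> 'M[R]_(n, m)) :
  0 < alpha < 1 -> 0 < T -> (0 < n)%N -> (0 < m)%N ->
  mxLp mu +oo%E setT A -> mxLp mu +oo%E setT B ->
  infinite_dimensional_L2 mu n ->
  ~ exactly_simultaneously_controllable mu alpha T A B.
Proof.
move=> /andP[alpha0 _] T0 n0 m0 LA LB inf ctrl.
have muT : (0 < mu setT < +oo)%E by rewrite probability_setT ltry lte01.
have [E [mE tE E0]] := disjoint_positive_sets R mu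
  (infinite_dimensional_L2_not_finitely_generated R mu n inf).
have muE F : measurable F -> (mu F < +oo)%E.
  by move=> mF; rewrite (le_lt_trans (probability_le1 mu mF))// ltry.
pose i0 : 'I_n := Ordinal n0.
pose Q k l s := (A s ^+ k *m B s) i0 l.
have mQ k l : measurable_fun setT (Q k l).
  by apply: mx_measurable_mulmx; [apply: mx_measurable_expr; case: LA|case: LB].
have [a a0 Aa] := mxLpy_ae_bounded R mu _ _ _ A (proj1 (andP muT)) LA.
have [b b0 Bb] := mxLpy_ae_bounded R mu _ _ _ B (proj1 (andP muT)) LB.
have aeF : Filter (almost_everywhere mu) by exact: ae_filter_ringOfSetsType.
have Qb k l : {ae mu, forall s, setT s -> `|Q k l s| <= n%:R * ((n%:R * a) ^+ k * b)}.
  apply: filterS2 Aa Bb => s Aa Bb _; rewrite /Q mxE (le_trans (ler_norm_sum _ _ _))//.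
  apply: (@le_trans _ _ (\sum_(h < n) (n%:R * a) ^+ k * b)).
    apply: ler_sum => h _; rewrite normrM ler_pM ?Bb//.
    by apply: normr_expmx_le => i j; exact: Aa.
  by rewrite sumr_const card_ord [X in _ <= X]mulr_natl.
(* the j-th set of the p-th block, blocks being laid out through [nat * nat -> nat] *)
pose blk p (j : 'I_(p * m).+1) := E (pickle (p, val j)).
have mblk p j : measurable (blk p j) by exact: mE.
have iblk p j : mu.-integrable setT (EFin \o (\1_(blk p j) : S -> R)).
  exact: integrable_indic.
have iblkQ p j k l : mu.-integrable setT (EFin \o (fun s => \1_(blk p j) s * Q k l s)).
  have [] := integrable_mulr_bounded R mu setT (\1_(blk p j)) (Q k l) _ measurableT _ _ _ _ (Qb k l) => //.
  by rewrite !mulr_ge0 ?exprn_ge0 ?mulr_ge0.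
(* There are p m + 1 unknowns for p m equations. *)
have /all_sig[xi xiP] p : {xi : 'I_(p * m).+1 -> R | (exists j, xi j != 0) /\
    forall kl : 'I_p * 'I_m, \sum_j xi j * \int[mu]_s (\1_(blk p j) s * Q kl.1 kl.2 s) = 0}.
  apply: cid; apply: (nontrivial_relation R _ _
    (fun j (kl : 'I_p * 'I_m) => \int[mu]_s (\1_(blk p j) s * Q kl.1 kl.2 s))).
  by rewrite card_prod !card_ord.
(* One target must carry the signs of all blocks at once, because p is chosen only after the
   control, which itself depends on the target. *)
pose z i : R := if unpickle i is Some pj then
  Num.sg (xi pj.1 (inord pj.2)) else 0.
have z1 i : `|z i| <= 1.
  by rewrite /z; case: unpickle => [pj|]; rewrite ?normr0// normr_sg; case: (_ != 0).
have [y [my y1 yE]] := piecewise_constant R E z 1 ler01 z1 mE tE.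
have yblk p j s : blk p j s -> y s = Num.sg (xi p j).
  by move=> /yE ->; rewrite /z pickleK/= inord_val.
pose x1 s : 'cV[R]_n := y s *: delta_mx i0 0.
have mu1 : (mu setT < +oo)%E by case/andP: muT.
have Lx0 : mxLp mu 2%:E setT (fun=> 0 : 'cV[R]_n).
  apply: (bounded_mxL2 R mu _ _ _ 0 mu1) => [i j|s i j]; last by rewrite mxE normr0.
  exact: measurable_cst.
have Lx1 : mxLp mu 2%:E setT x1.
  apply: (bounded_mxL2 R mu _ _ _ 1 mu1) => [i j|s i j].
    by under eq_fun do rewrite mxE; exact: measurable_funM.
  by rewrite !mxE normrM mulr_ile1//; case: (_ && _); rewrite ?normr0 ?normr1.
have [u [[mu_ u_bounded] solu]] := ctrl _ _ Lx0 Lx1.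
have lebT : (0 < @lebesgue_measure R setT)%E.
  by rewrite -set_itvNyy lebesgue_measure_itv/= ltry.
have [N N0 uN] := mxLpy_ae_bounded R lebesgue_measure _ _ _ u lebT (conj mu_ u_bounded).
have [C C0 HC] := solution_tail R n m alpha T a b alpha0 T0 a0 b0.
have uN0 : {ae lebesgue_measure, forall s, (`]0, T[%classic : set R) s ->
    forall l, `|u s l 0| <= N}.
  have FF : Filter (almost_everywhere (@lebesgue_measure R)).
    exact: (ae_filter_ringOfSetsType lebesgue_measure).
  by apply: filterS uN => s us Ds l; exact: us.
have [v vP] := HC N u N0 (mu_^~ 0) uN0.
have [p Np] : exists p, C * N * 2^-1 ^+ p < 1.
  (* It suffices that C N < p, since p < 2^p. *)
  have [p Np] : exists p : nat, C * N < p%:R.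
    by exists (Num.bound (C * N)); rewrite archi_boundP// mulr_ge0.
  exists p; rewrite exprVn ltr_pdivrMr ?exprn_gt0// mul1r (lt_le_trans Np)//.
  by rewrite -natrX ler_nat ltnW// ltn_expl.
have ep0 : 0 <= C * N * 2^-1 ^+ p by rewrite !mulr_ge0 ?exprn_ge0.
have [[j0 xij0] xi0] := xiP p.
(* [w] is |g_p|, and [w * y] is g_p itself, by the choice of signs. *)
pose w s := \sum_(j < (p * m).+1) `|xi p j| * \1_(blk p j) s.
have w_ge0 s : 0 <= w s by apply: sumr_ge0 => j _; rewrite mulr_ge0 ?indicE.
have wy s : w s * y s = \sum_(j < (p * m).+1) xi p j * \1_(blk p j) s.
  rewrite /w mulr_suml; apply: eq_bigr => j _; rewrite indicE.
  have [sj|sj] := boolP (s \in blk p j); last by rewrite !mulr0 mul0r.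
  by rewrite !mulr1 (yblk p j s (set_mem sj)) mulrC mulr_sg_norm.
have wyy s : w s * (y s * y s) = w s.
  rewrite /w mulr_suml; apply: eq_bigr => j _; rewrite indicE.
  have [sj|sj] := boolP (s \in blk p j); last by rewrite !mulr0 mul0r.
  rewrite mulr1 (yblk p j s (set_mem sj)) -expr2 sqr_sg.
  (* y^2 is 1 where xi_(p,j) is nonzero; elsewhere the weight vanishes. *)
  by have [->|_] := eqVneq (xi p j) 0; rewrite ?normr0 ?mul0r ?mulr1.
have [iw Iw] := Rintegral_lincomb R mu setT _ (index_enum 'I_(p * m).+1) (fun j => `|xi p j|)
  (fun j => \1_(blk p j)) measurableT (iblk p).
have w_gt0 : 0 < \int[mu]_s w s.
  rewrite Iw (bigD1 j0)//=; apply: ltr_wpDr.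
    by apply: sumr_ge0 => j _; rewrite mulr_ge0// Rintegral_ge0// => s _; rewrite indicE.
  rewrite mulr_gt0 ?normr_gt0// /Rintegral integral_indic// setIT.
  by rewrite fine_gt0// E0 muE.
(* As the control reaches the target, [r] is the tail of its expansion from k = p on. *)
pose r s := y s - \sum_(kl : 'I_p * 'I_m) v kl.1 kl.2 * Q kl.1 kl.2 s.
have rb : {ae mu, forall s, setT s -> `|y s * r s| <= C * N * 2^-1 ^+ p}.
  apply: filterS3 Aa Bb solu => s Aa Bb solu _.
  rewrite normrM (le_trans (ler_piMl _ (y1 s)))//.
  have := vP (A s) (B s) (Aa I) (Bb I) i0 p.
  rewrite solu /x1 !mxE !eqxx mulr1; congr (`|_ - _| <= _).
  by apply: eq_bigr => kl _; rewrite mulrC.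
have mr : measurable_fun setT (fun s => y s * r s).
  apply: measurable_funM => //; apply: measurable_funB => //.
  by apply: measurable_sum => kl; apply: measurable_funM.
have [iwr wr] := integrable_mulr_bounded R mu setT w _ _ measurableT (fun s _ => w_ge0 s) iw mr ep0 rb.
have wyQ (kl : 'I_p * 'I_m) : mu.-integrable setT (EFin \o (fun s => w s * y s * Q kl.1 kl.2 s)) /\
    \int[mu]_s (w s * y s * Q kl.1 kl.2 s) = 0.
  have [iQ IQ] := Rintegral_lincomb R mu setT _ (index_enum 'I_(p * m).+1) (xi p)
    (fun j s => \1_(blk p j) s * Q kl.1 kl.2 s) measurableT (fun j => iblkQ p j kl.1 kl.2).
  have wyE : (fun s => w s * y s * Q kl.1 kl.2 s) =
    (fun s => \sum_(j < (p * m).+1) xi p j * (\1_(blk p j) s * Q kl.1 kl.2 s)).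
    by apply/funext => s; rewrite wy mulr_suml; apply: eq_bigr => j _; rewrite mulrA.
  by rewrite wyE; split => //; rewrite IQ xi0.
have [iwQ wQ] := Rintegral_lincomb R mu setT _ (index_enum ('I_p * 'I_m)%type)
  (fun kl => v kl.1 kl.2) (fun kl s => w s * y s * Q kl.1 kl.2 s) measurableT
  (fun kl => (wyQ kl).1).
(* The relation [xi p] annihilates the p subtracted terms, and what remains is w y^2 = w. *)
have wint : \int[mu]_s (w s * (y s * r s)) = \int[mu]_s w s.
  have -> : (fun s => w s * (y s * r s)) = (fun s => w s - \sum_(kl : 'I_p * 'I_m)
      v kl.1 kl.2 * (w s * y s * Q kl.1 kl.2 s)).
    apply/funext => s; rewrite /r !mulrBr wyy mulrA mulr_sumr; congr (_ - _).
    by apply: eq_bigr => kl _; rewrite mulrCA.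
  rewrite RintegralB// wQ big1 ?subr0// => kl _.
  by rewrite (wyQ kl).2 mulr0.
have := wr; rewrite wint ger0_norm ?(ltW w_gt0)//.
by rewrite leNgt gtr_pMl// Np.
Qed.
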